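(* Let $R$ be a commutative noetherian ring with unit. Then $R$ is a Rado ring if and only if for every associated prime $\mathfrak p$ of the $R$-module $R$, either $R/\mathfrak p$ is a finite field or the localisation $R_{\mathfrak p}$ is a field.
   Context: Partition regularity: for a ring $R$, an $R$-module $M$, a $k\times l$ matrix $\mathbf{A}$ over $R$, $\mathbf{A}$ is partition regular over $M$ if for every $r\ge1$ and every map $\chi\colon M\to\{1,\dots,r\}$ there is $\mathbf{m}=(m_1,\dots,m_l)^{\intercal}\in M^l$, $\mathbf m\ne 0$, with $\mathbf{A}\mathbf{m}=0$ and $\chi(m_1)=\dots=\chi(m_l)$. Generalised columns condition: with $\mathbf c_1,\dots,\mathbf c_l\in R^k$ the columns of $\mathbf A$, $\mathbf A$ satisfies it if there exist an integer $m\ge0$, a partition $\{1,\dots,l\}=I_0\cup\dots\cup I_m$, and elements $d_0,\dots,d_m\in R\setminus\{0\}$ such that (i) $d_0\sum_{i\in I_0}\mathbf c_i=0$; (ii) for $t\in\{1,\dots,m\}$, $d_t\sum_{i\in I_t}\mathbf c_i$ lies in the $R$-submodule of $R^k$ generated by the $\mathbf c_j$ with $j\in I_0\cup\dots\cup I_{t-1}$; (iii) if $m>0$, then for every $n\ge0$ the ideal $d_0(d_1\cdots d_m)^nR$ is infinite. Every matrix satisfying the generalised columns condition is partition regular over $R$; $R$ is a Rado ring if conversely every matrix with entries in $R$ that is partition regular over $R$ satisfies the generalised columns condition. An associated prime of $R$ is a prime ideal of the form $\mathrm{ann}(c)=\{x\in R: xc=0\}$ for some $c\in R$. *)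

(* Defs.v *)
From HB Require Import structures.
From mathcomp Require Import all_boot all_order all_algebra.
Set Implicit Arguments. Unset Strict Implicit. Unset Printing Implicit Defensive.
Import Order.TTheory GRing.Theory.
Local Open Scope ring_scope.

Section RadoDefs.
Variable R : comPzRingType.

Definition is_ideal (I : R -> Prop) : Prop :=
  [/\ I 0, (forall x y, I x -> I y -> I (x + y)) & (forall r x, I x -> I (r * x))].

Definition noetherian_ring : Prop :=
  forall I : nat -> R -> Prop,
    (forall n, is_ideal (I n)) ->
    (forall n x, I n x -> I n.+1 x) ->
    exists N, forall n, (N <= n)%N -> forall x, I n x <-> I N x.

Definition prime_ideal (p : R -> Prop) : Prop :=
  [/\ is_ideal p, ~ p 1 & (forall a b, p (a * b) -> p a \/ p b)].

Definition ann (c : R) : R -> Prop := fun x => x * c = 0.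

Definition associated_prime (p : R -> Prop) : Prop :=
  prime_ideal p /\ exists c : R, forall x, p x <-> ann c x.

Definition finite_subset (S : R -> Prop) : Prop :=
  exists s : seq R, forall x, S x -> x \in s.

(* R/p is a finite field (written out on representatives, congruence mod p):
   R/p is nonzero, every nonzero class is invertible, and R/p has
   finitely many elements. *)
Definition quotient_is_finite_field (p : R -> Prop) : Prop :=
  [/\ ~ p 1,
      (forall x, ~ p x -> exists y, p (x * y - 1)) &
      (exists s : seq R, forall x, exists2 y, y \in s & p (x - y))].

(* The localisation R_p = S^{-1} R, S = R \ p, written out on fractions a/s,
   where a/s = a'/s' iff u (a s' - a' s) = 0 for some u in S:
   R_p is nonzero (1/1 <> 0/1) and every nonzero fraction is invertible. *)
Definition localisation_is_field (p : R -> Prop) : Prop :=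
  (~ exists u, ~ p u /\ u * 1 = 0) /\
  (forall a s, ~ p s ->
     ~ (exists u, ~ p u /\ u * a = 0) ->
     exists b t u, [/\ ~ p t, ~ p u & u * (a * b - s * t) = 0]).

Definition partition_regular (k l : nat) (A : 'M[R]_(k, l)) : Prop :=
  forall r : nat, (0 < r)%N -> forall chi : R -> 'I_r,
    exists m : 'cV[R]_l,
      [/\ m != 0, A *m m = 0 & forall i j, chi (m i 0) = chi (m j 0)].

(* Generalised columns condition.  The partition I_0, ..., I_m of the column
   indices is given by f : 'I_l -> 'I_m.+1 (I_t = f^-1(t)), parts nonempty. *)
Definition generalised_columns_condition (k l : nat) (A : 'M[R]_(k, l)) : Prop :=
  exists (m : nat) (f : 'I_l -> 'I_m.+1) (d : 'I_m.+1 -> R),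
    [/\ (forall t, exists i, f i = t),
        (forall t, d t != 0),
        d ord0 *: (\sum_(i | f i == ord0) col i A) = 0,
        (forall t : 'I_m.+1, (0 < t)%N ->
           exists a : 'I_l -> R,
             d t *: (\sum_(i | f i == t) col i A)
             = \sum_(j | (f j < t)%N) a j *: col j A) &
        ((0 < m)%N -> forall n : nat,
           ~ finite_subset
               (fun x => exists y,
                  x = d ord0 * (\prod_(t < m.+1 | (0 < t)%N) d t) ^+ n * y))].

Definition rado_ring : Prop :=
  forall (k l : nat) (A : 'M[R]_(k, l)),
    partition_regular A -> generalised_columns_condition A.

End RadoDefs.

(* Main.v *)
(* Necessity.  Let p = ann c be associated with R/p infinite and R_p not a
   field, and let the a_i generate p.  The system x - y + z = 0,
   a_i x = a_i y = a_i z = 0 has monochromatic solutions in Rc = R/p by Schur's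
   theorem, but in the columns condition both d_0 and d_1 must annihilate p;
   since R_p is not a field ann p lies in p, so d_0 d_1 = 0.

   Sufficiency.  Call u special if ann u is a prime not containing u.  Finitely
   many special elements u_1, ..., u_n generate the ideal of all of them, and
   N = ann(u_1, ..., u_n) is finite: an associated prime of N is never of the
   form ann u with u special, so by hypothesis its residue field is finite.
   Colour the elements of R by their classes in N and by suitable colourings of
   the domains R/ann(u_i).  Either some monochromatic solution yields the
   columns condition over R/ann(u_i), which lifts to R after multiplication by
   u_i, or the solution lies in N, hence is constant, which gives the condition
   with m = 0.

   For an infinite domain R/p with fraction field K the colouring is Rado's
   last-digit colouring in disguise.  Specialise a finitely generated subring
   of K to a finite field F without killing finitely many given nonzero
   elements.  In a maximal chain of submodules of K over the localisation at
   the kernel, consecutive quotients are one-dimensional over F; the colour of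
   x is its coordinate in the quotient where x appears, and the order of the
   chain gives the partition of the columns. *)

Require Import Defs.
From HB Require Import structures.
From mathcomp Require Import all_boot all_order all_algebra all_field.
From mathcomp Require Import ring_quotient generic_quotient fraction.
From mathcomp Require Import boolp classical_sets ring.
Set Implicit Arguments. Unset Strict Implicit. Unset Printing Implicit Defensive.
Import Order.TTheory GRing.Theory.
Local Open Scope ring_scope.

(** * Specialisation to finite fields *)

Lemma min_measure (T : Type) (P : T -> Prop) (m : T -> nat) :
  (exists x, P x) -> exists2 x, P x & forall y, P y -> (m x <= m y)%N.
Proof.
move=> [x0 Px0].
have exP : exists n, `[< exists2 x, P x & m x = n >].
  by exists (m x0); apply/asboolP; exists x0.
case: (ex_minnP exP) => n /asboolP[x Px <-] nmin.
by exists x => // y Py; apply: nmin; apply/asboolP; exists y.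
Qed.

(** * Algebraic elements over the image of a ring map *)

Section PolyImage.
Variables (B : comNzRingType) (K : fieldType) (g : {rmorphism B -> K}).

(** As [g] may kill leading coefficients, sizes over [B] and over [K] can differ; cutting at the
    size of the image makes them agree without changing that image. *)
Definition trim_poly (P : {poly B}) : {poly B} :=
  take_poly (size (map_poly g P)) P.

Lemma map_trim_poly P : map_poly g (trim_poly P) = map_poly g P.
Proof.
apply/polyP => i; rewrite !coef_map coef_take_poly.
case: ltnP => // le_i; rewrite raddf0.
by rewrite -[RHS]coef_map nth_default.
Qed.

Lemma size_map_poly_le P : (size (map_poly g P) <= size P)%N.
Proof. exact: size_poly. Qed.

Lemma size_trim_poly P : size (trim_poly P) = size (map_poly g P).
Proof.
apply/eqP; rewrite eqn_leq size_take_poly /=.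
by rewrite -map_trim_poly size_map_poly_le.
Qed.

Lemma lead_trim_poly P :
  map_poly g P != 0 -> g (lead_coef (trim_poly P)) != 0.
Proof.
move=> nzP; rewrite lead_coefE size_trim_poly -coef_map map_trim_poly.
by rewrite -lead_coefE lead_coef_eq0.
Qed.

Variable x : K.

Definition eval_at : {poly B} -> K :=
  horner_morph (fun a => mulrC x (g a)).
HB.instance Definition _ := GRing.RMorphism.on eval_at.

Lemma eval_atE P : eval_at P = (map_poly g P).[x]. Proof. by []. Qed.

Lemma eval_atZ a P : eval_at (a *: P) = g a * eval_at P.
Proof. by rewrite -mul_polyC rmorphM /= [eval_at _%:P]eval_atE map_polyC hornerC. Qed.

Lemma eval_trim_poly P : eval_at (trim_poly P) = eval_at P.
Proof. by rewrite !eval_atE map_trim_poly. Qed.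

Definition relation_poly (P : {poly B}) := eval_at P = 0 /\ map_poly g P != 0.

(** Plays the minimal polynomial of [x] over the fractions of [g(B)], with coefficients lifted to
    [B]; only pseudo-division by it is available. *)
Definition minimal_relation (M : {poly B}) :=
  [/\ relation_poly M, g (lead_coef M) != 0, size (map_poly g M) = size M &
      forall Q, relation_poly Q -> (size M <= size Q)%N].

Lemma minimal_relation_exists P :
  relation_poly P -> exists M, minimal_relation M.
Proof.
move=> relP.
have [M [M0 nzM] minM] :=
  min_measure (fun P => size (map_poly g P)) (ex_intro _ P relP).
exists (trim_poly M); split.
- by split; rewrite ?eval_trim_poly ?map_trim_poly.
- exact: lead_trim_poly.
- by rewrite map_trim_poly size_trim_poly.
- move=> Q relQ; rewrite size_trim_poly.
  exact: leq_trans (minM Q relQ) (size_map_poly_le Q).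
Qed.

Lemma minimal_relation_small M Q : minimal_relation M ->
  eval_at Q = 0 -> (size Q < size M)%N -> map_poly g Q = 0.
Proof.
move=> [_ _ _ minM] Q0; apply: contraTeq => nzQ.
by rewrite -leqNgt; apply: minM.
Qed.

(* An element algebraic over the image of [g] has a nonzero multiple in that
   image: a multiple [P(x)] of minimal degree is constant, for otherwise
   pseudo-dividing the minimal relation by [P] gives a shorter one. *)
Lemma multiple_in_image M (s : {poly B}) : minimal_relation M ->
  eval_at s != 0 -> exists U c, eval_at U * eval_at s = g c /\ g c != 0.
Proof.
move=> minM nzs.
pose mult P := eval_at P != 0 /\ exists U, eval_at U * eval_at s = eval_at P.
have [P0 multP0 minP0] : exists2 P, mult P &
    forall Q, mult Q -> (size (map_poly g P) <= size (map_poly g Q))%N.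
  by apply: min_measure; exists s; split => //; exists 1; rewrite rmorph1 mul1r.
pose P := trim_poly P0.
have [nzP [U defU]] : mult P.
  by case: multP0 => ? [U ?]; split; [|exists U]; rewrite eval_trim_poly.
have minP Q : mult Q -> (size P <= size Q)%N.
  move=> multQ; rewrite size_trim_poly.
  exact: leq_trans (minP0 Q multQ) (size_map_poly_le Q).
have szP : size (map_poly g P) = size P by rewrite map_trim_poly size_trim_poly.
have P_neq0 : P != 0 by apply: contraNneq nzP => ->; rewrite rmorph0.
have [[M0 nzM] nzlM szM _] := minM.
have M_neq0 : M != 0 by apply: contraNneq nzM => ->; rewrite rmorph0.
(* The remainder of [P] modulo [M] takes at [x] a nonzero multiple of the value of [P], so
   minimality makes [P] no longer than that remainder. *)
have szPM : (size P < size M)%N.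
  case: (Pdiv.ComRing.redivpP P M) => k q r defr /(_ M_neq0).
  apply: leq_ltn_trans; apply: minP; split.
    have := congr1 eval_at defr; rewrite eval_atZ rmorphD rmorphM /= M0 mulr0.
    by rewrite add0r => <-; rewrite mulf_neq0 // rmorphXn expf_neq0.
  exists ((lead_coef M ^+ k)%:P * U).
  have := congr1 eval_at defr; rewrite eval_atZ rmorphD rmorphM /= M0 mulr0.
  rewrite add0r => <-; rewrite rmorphM /= -mulrA defU; congr (_ * _).
  by rewrite eval_atE map_polyC hornerC.
case: (Pdiv.ComRing.redivpP M P) => k q r defr /(_ P_neq0) szr.
have eval_r : eval_at r = - (eval_at q * eval_at P).
  apply/eqP; rewrite -addr_eq0 addrC -rmorphM -rmorphD /= -defr eval_atZ M0.
  by rewrite mulr0.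
(* This remainder is again a multiple of [s] at [x], but shorter than [P]. *)
have r0 : eval_at r = 0.
  apply/eqP; apply: contraTT szr => nzr; rewrite -leqNgt; apply: minP.
  split=> //; exists (- (q * U)).
  by rewrite eval_r rmorphN rmorphM /= mulNr -mulrA defU.
have map_r : map_poly g r = 0.
  by apply: minimal_relation_small minM r0 _; apply: ltn_trans szr szPM.
have [szP1 | szP2] := leqP (size P) 1.
  exists U, P`_0; rewrite defU; have P_C := size1_polyC szP1.
  have gP : eval_at P = g P`_0 by rewrite {1}P_C eval_atE map_polyC hornerC.
  by rewrite -gP.
have nzlP : g (lead_coef P) != 0.
  by apply: lead_trim_poly; rewrite -size_poly_eq0 -map_trim_poly szP size_poly_eq0.
have q0 : eval_at q = 0.
  move/eqP: r0; rewrite eval_r oppr_eq0 mulf_eq0 (negbTE nzP) orbF.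
  by move/eqP.
have map_q : g (lead_coef P) ^+ k *: map_poly g M = map_poly g q * map_poly g P.
  have := congr1 (map_poly g) defr.
  by rewrite rmorphD rmorphM /= map_r addr0 map_polyZ rmorphXn.
have nzq : map_poly g q != 0.
  apply/eqP => mq0; move/eqP: map_q; rewrite mq0 mul0r scaler_eq0.
  by rewrite expf_eq0 (negbTE nzlP) andbF (negbTE nzM).
have nzmP : map_poly g P != 0 by rewrite -size_poly_eq0 szP size_poly_eq0.
have := congr1 (fun p : {poly K} => size p) map_q.
rewrite /= size_scale ?expf_neq0 // size_mul // szM szP => szE.
have szMq : (size M <= size (map_poly g q))%N.
  rewrite -size_trim_poly; case: minM => _ _ _; apply.
  by split; rewrite ?eval_trim_poly ?map_trim_poly.
move: szMq; rewrite szE -(prednK (ltnW szP2)) addnS /= leqNgt.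
by rewrite -{1}[size _]addn0 ltn_add2l -ltnS prednK ?szP2 // ltnW.
Qed.

End PolyImage.

Lemma finField_root (F : finFieldType) (p : {poly F}) : (1 < size p)%N ->
  exists (F' : finFieldType) (i : {rmorphism F -> F'}) (y : F'),
    root (map_poly i p) y.
Proof.
move=> szp; have nzp : p != 0 by rewrite -size_poly_gt0 ltnW.
have [L [rs splitL _]] := FinSplittingFieldFor nzp.
have : size rs != 0%N.
  move/eqp_size: splitL; rewrite size_map_poly size_prod_XsubC => szE.
  by rewrite -eqSS -szE gtn_eqF.
case: rs splitL => // y rs splitL _.
exists (finvect_type L), (GRing.in_alg L), y.
rewrite (eqp_root splitL) root_prod_XsubC; exact: mem_head.
Qed.

(** A Nullstellensatz for the subring [g(B)]: the first clause makes [h] factor through it.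
    Presenting the subring by [B] and [g] lets generators be adjoined as polynomial variables. *)
Definition specializable (B : comNzRingType) (K : fieldType)
    (g : {rmorphism B -> K}) :=
  forall c, g c != 0 -> exists (F : finFieldType) (h : {rmorphism B -> F}),
    (forall z, g z = 0 -> h z = 0) /\ h c != 0.

(** Reduction modulo the characteristic of [K] works if it is positive; otherwise modulo a prime
    larger than the absolute value of [c]. *)
Lemma specializable_int (K : fieldType) (g : {rmorphism int -> K}) :
  specializable g.
Proof.
have gE z : g z = z%:~R by rewrite -{1}[z]intz rmorph_int.
have char_case (p : nat) c : prime p -> (forall z, g z = 0 -> (p %| z)%Z) ->
    ~~ (p %| c)%Z ->
    exists (F : finFieldType) (h : {rmorphism int -> F}),
      (forall z, g z = 0 -> h z = 0) /\ h c != 0.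
  move=> p_pr kerg ndvd_c; exists 'F_p, intr; split=> [z /kerg|] /=.
    by rewrite (dvdz_pcharf (pchar_Fp p_pr)) => /eqP.
  by rewrite -(dvdz_pcharf (pchar_Fp p_pr)).
move=> c; have [[p charK]|char0] := pselect (exists p, p \in [pchar K]).
  rewrite gE -(dvdz_pcharf charK) => ndvd_c.
  apply: (char_case p) => // [|z]; first by case/andP: charK.
  by rewrite gE (dvdz_pcharf charK) => ->.
move=> nzc; have [p ltp p_pr] := prime_above `|c|%N.
have c_neq0 : c != 0 by apply: contraNneq nzc => ->; rewrite rmorph0.
apply: (char_case p) => // [z|].
  rewrite gE => z0; suff -> : z = 0 by rewrite dvdz0.
  apply/eqP; apply: contra_notT char0 => nzz; apply: (@natf0_pchar _ `|z|%N).
    by rewrite absz_gt0.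
  case: z z0 {nzz} => n /eqP //.
  by rewrite NegzE mulrNz oppr_eq0 abszN.
by rewrite dvdzE /= gtnNdvd // absz_gt0.
Qed.

Lemma specializable_poly (B : comNzRingType) (K : fieldType)
    (g : {rmorphism B -> K}) (x : K) :
  specializable g -> specializable (eval_at g x).
Proof.
move=> specg s nzs.
have [|noM] := pselect (exists M, minimal_relation g x M).
  move=> [M minM]; have [U [c [defc nzc]]] := multiple_in_image minM nzs.
  have [[M0 nzM] nzb szM _] := minM; set b := lead_coef M in nzb.
  (* Keeping [b] nonzero preserves the degree of [M], hence a root in a finite extension; keeping
     [c] nonzero will keep [s] nonzero. *)
  have nzbc : g (b * c) != 0 by rewrite rmorphM mulf_neq0.
  have [F [h [kerh]]] := specg _ nzbc.
  rewrite rmorphM mulf_eq0 negb_or => /andP[hb hc].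
  have szhM : size (map_poly h M) = size M by rewrite size_map_poly_id0.
  have szM1 : (1 < size M)%N.
    rewrite ltnNge; apply: contra nzM => /size1_polyC defM.
    move: M0; rewrite defM eval_atE map_polyC hornerC => ->.
    by rewrite polyC0.
  have [F' [i [y rooty]]] : exists (F' : finFieldType)
      (i : {rmorphism F -> F'}) (y : F'), root (map_poly i (map_poly h M)) y.
    by apply: finField_root; rewrite szhM.
  have kerh' z : g z = 0 -> (i \o h) z = 0 by move=> /kerh /= ->; rewrite rmorph0.
  have hb' : (i \o h) b != 0 by rewrite fmorph_eq0.
  rewrite -map_poly_comp in rooty.
  pose h' := eval_at (i \o h) y.
  (* The remainder of [z] modulo [M] is killed by [g], hence by [h]; at the root [y] of [M] this
     leaves a power of [b] times the value of [z]. *)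
  have kerh'' z : eval_at g x z = 0 -> h' z = 0.
    move=> z0; have M_neq0 : M != 0 by rewrite -size_poly_gt0 ltnW.
    case: (Pdiv.ComRing.redivpP z M) => k q r defr /(_ M_neq0) szr.
    have r0 : map_poly g r = 0.
      apply: minimal_relation_small minM _ szr.
      have := congr1 (eval_at g x) defr.
      by rewrite eval_atZ rmorphD rmorphM /= z0 M0 !mulr0 add0r.
    have := congr1 h' defr; rewrite /h' eval_atZ rmorphD rmorphM /=.
    rewrite [eval_at _ _ M]eval_atE (rootP rooty) mulr0 add0r [RHS]eval_atE.
    have -> : map_poly (i \o h) r = 0.
      apply/polyP => j; rewrite coef_map coef0 /=; apply: kerh'.
      by rewrite -coef_map r0 coef0.
    rewrite horner0 => /eqP; rewrite mulf_eq0 -/b !rmorphXn expf_eq0 /=.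
    by rewrite [i _ == 0](negbTE hb') andbF => /eqP.
  exists F', h'; split=> //.
  have : eval_at g x (U * s - c%:P) = 0.
    by rewrite rmorphB rmorphM /= defc [X in _ - X]eval_atE map_polyC hornerC subrr.
  move/kerh''; rewrite /h' rmorphB rmorphM /= [X in _ - X]eval_atE map_polyC hornerC /=.
  move/eqP; rewrite subr_eq0 => /eqP hUs; apply: contraNneq hc => s0.
  by rewrite -(fmorph_eq0 i) -hUs s0 mulr0.
have transc z : eval_at g x z = 0 -> map_poly g z = 0.
  move=> z0; apply/eqP; apply: contra_notT noM => nzz.
  exact: (@minimal_relation_exists _ _ _ _ z).
have : map_poly g s != 0.
  by apply: contraNneq nzs => s0; rewrite /= eval_atE s0 horner0.
rewrite -lead_coef_eq0 lead_coefE coef_map => /specg[F [h [kerh nzh]]].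
have nzhs : map_poly h s != 0.
  by apply: contraNneq nzh => hs0; rewrite -coef_map hs0 coef0.
(* A root of [s * 'X + 1] is never a root of [s]; passing to an extension matters when [s] vanishes
   on all of [F]. *)
have [F' [i [y rooty]]] : exists (F' : finFieldType)
    (i : {rmorphism F -> F'}) (y : F'), root (map_poly i (map_poly h s * 'X + 1)) y.
  apply: finField_root; rewrite -[1](polyC1) size_MXaddC (negbTE nzhs) /=.
  by rewrite ltnS size_poly_gt0.
exists F', (eval_at (i \o h) y); split=> [z /transc z0|].
  rewrite /= eval_atE; have -> : map_poly (i \o h) z = 0; last by rewrite horner0.
  apply/polyP => j; rewrite coef_map coef0 /= [h _]kerh ?rmorph0 //.
  by rewrite -coef_map z0 coef0.
rewrite /= eval_atE map_poly_comp; apply: contraTneq rooty => s0.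
rewrite /root rmorphD rmorphM /= map_polyX rmorph1 hornerD hornerM s0 mul0r.
by rewrite add0r hornerC oner_eq0.
Qed.

Lemma specialization (K : fieldType) (xs : seq K) :
  exists (B : comNzRingType) (g : {rmorphism B -> K}),
    specializable g /\ forall x, x \in xs -> exists b, g b = x.
Proof.
elim: xs => [|x xs [B [g [specg img]]]].
  by exists int, intr; split=> //; apply: specializable_int.
exists {poly B}, (eval_at g x); split; first exact: specializable_poly.
move=> y; rewrite inE => /predU1P[->|/img[b <-]].
  by exists 'X; rewrite /= eval_atE map_polyX hornerX.
by exists b%:P; rewrite /= eval_atE map_polyC hornerC.
Qed.

Lemma finField_specialization (K : fieldType) (xs : seq K) :
  exists (B : comNzRingType) (g : {rmorphism B -> K})
         (F : finFieldType) (h : {rmorphism B -> F}),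
    (forall z, g z = 0 -> h z = 0) /\
    (forall x, x \in xs -> exists b, g b = x /\ (x != 0 -> h b != 0)).
Proof.
have [B [g [specg img]]] := specialization xs.
have [b gb] : exists b : K -> B, forall x, x \in xs -> g (b x) = x.
  suff /choice[b ?] : forall x, exists b, x \in xs -> g b = x by exists b.
  move=> x; have [/img[b <-]|] := boolP (x \in xs); first by exists b.
  by exists 0.
(* One product encodes all the nonvanishing conditions at once. *)
pose c := \prod_(x <- xs | x != 0) b x.
have nzc : g c != 0.
  rewrite /c big_seq_cond rmorph_prod prodf_seq_neq0; apply/allP => x xs_x.
  by apply/implyP => /andP[/gb-> ].
have [F [h [kerh]]] := specg c nzc.
rewrite /c rmorph_prod prodf_seq_neq0 => /allP nzh.
exists B, g, F, h; split=> // x xs_x; exists (b x); split; first exact: gb.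
by move=> nzx; apply: (implyP (nzh x xs_x)).
Qed.
(** * Leading digits along a maximal chain of submodules *)

Section LeadingDigit.
Variables (B : comNzRingType) (K : fieldType) (g : {rmorphism B -> K}).
Variables (F : finFieldType) (h : {rmorphism B -> F}).
Hypothesis ker_gh : forall z, g z = 0 -> h z = 0.

(* These are the submodules of [K] over the localisation of [g(B)] at [ker h]. *)
Definition saturated (W : K -> Prop) :=
  [/\ W 0, (forall x y, W x -> W y -> W (x + y)),
      (forall b x, W x -> W (g b * x)) &
      (forall b x, h b != 0 -> W (g b * x) -> W x)].

Definition saturated_chain (C : set (set K)) :=
  (forall W, C W -> saturated W) /\ total_on C subset.

Definition maximal_chain (C : set (set K)) :=
  saturated_chain C /\
  forall U : set K, saturated U ->
    (forall W, C W -> subset W U \/ subset U W) -> C U.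

Lemma maximal_chain_exists : exists C, maximal_chain C.
Proof.
have [] := @Zorn_bigcup _ saturated_chain.
  move=> S chainS totS; split=> [W [C SC CW]|W1 W2 [C1 SC1 CW1] [C2 SC2 CW2]].
    exact: (chainS C SC).1.
  have [C12|C21] := totS _ _ SC1 SC2.
    by apply: (chainS C2 SC2).2 => //; apply: C12.
  by apply: (chainS C1 SC1).2 => //; apply: C21.
move=> C [chainC maxC]; exists C; split=> // U satU cmpU.
apply: contrapT => nCU; apply: (maxC (fun W => C W \/ W = U)).
  split=> [W CW|CU]; first by left.
  by apply: nCU; apply: CU; right.
have [satC totC] := chainC.
split=> [W [/satC|->] //|W1 W2 [CW1|->] [CW2|->]].
- exact: totC.
- exact: cmpU.
- by case: (cmpU _ CW2); [right|left].
- by left.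
Qed.

Variable C : set (set K).
Hypothesis maxC : maximal_chain C.

Let satC W : C W -> saturated W. Proof. by case: maxC => -[+ _ _]; apply. Qed.
Let totC W1 W2 : C W1 -> C W2 -> subset W1 W2 \/ subset W2 W1.
Proof. by case: maxC => -[_ +] _; apply. Qed.

(* [weakly_below x] and [strictly_below x] are the two consecutive members of
   the chain between which [x] appears. *)
Definition weakly_below (x y : K) := forall W, C W -> W x -> W y.
Definition strictly_below (x y : K) := exists W, [/\ C W, W y & ~ W x].
Definition same_level (x y : K) := weakly_below x y /\ weakly_below y x.

Lemma saturated_opp W x : saturated W -> W x -> W (- x).
Proof.
by case=> _ _ mulW _ /(mulW (-1)); rewrite rmorphN rmorph1 mulN1r.
Qed.

Lemma saturated_zero : saturated (fun x => x = 0).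
Proof.
split=> [//|x y -> ->|b x ->|b x hb /eqP]; rewrite ?addr0 ?mulr0 //.
rewrite mulf_eq0 => /orP[/eqP/ker_gh b0|/eqP //].
by rewrite b0 eqxx in hb.
Qed.

(** The zero submodule is saturated and comparable with everything, so maximality puts it in the
    chain. *)
Lemma strictly_below0 x : x != 0 -> strictly_below x 0.
Proof.
move=> nzx; exists (fun x => x = 0); split=> //; last exact/eqP.
case: maxC => _; apply; first exact: saturated_zero.
by move=> W /satC[W0 _ _ _]; right => y ->.
Qed.

Lemma weakly_below_trans y x z :
  weakly_below x y -> weakly_below y z -> weakly_below x z.
Proof. by move=> xy yz W CW /(xy W CW); apply: yz. Qed.

Lemma weakly_below_total x y : weakly_below x y \/ strictly_below y x.
Proof.
have [|nxy] := pselect (weakly_below x y); first by left.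
right; apply: contrapT => nsyx; apply: nxy => W CW Wx.
by apply: contrapT => nWy; apply: nsyx; exists W.
Qed.

Lemma strictly_weakly_below x y : strictly_below x y -> weakly_below x y.
Proof.
move=> [W [CW Wy nWx]] W' CW' W'x.
by have [sW|sW] := totC CW CW'; [apply: sW|case: nWx; apply: sW].
Qed.

Lemma strictly_belowP x y : strictly_below x y <-> ~ weakly_below y x.
Proof.
split=> [[W [CW Wy nWx]] /(_ W CW Wy)//|nyx].
by have [] := weakly_below_total y x.
Qed.

Lemma strictly_below_sub x y W :
  C W -> strictly_below x y -> W x -> W y.
Proof. by move=> CW /strictly_weakly_below; apply. Qed.

Lemma strictly_below_level x x' y :
  same_level x x' -> strictly_below x y -> strictly_below x' y.
Proof.
move=> [_ x'x] [W [CW Wy nWx]]; exists W; split=> // Wx'.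
by apply: nWx; apply: x'x.
Qed.

Lemma saturated_strictly_below x : x != 0 -> saturated (strictly_below x).
Proof.
move=> nzx; split; first exact: strictly_below0.
- move=> y1 y2 [W1 [CW1 W1y1 nW1x]] [W2 [CW2 W2y2 nW2x]].
  have [s12|s21] := totC CW1 CW2; [exists W2|exists W1]; split=> //.
    by have [_ addW _ _] := satC CW2; apply: addW => //; apply: s12.
  by have [_ addW _ _] := satC CW1; apply: addW => //; apply: s21.
- move=> b y [W [CW Wy nWx]]; exists W; split=> //.
  by have [_ _ mulW _] := satC CW; apply: mulW.
- move=> b y hb [W [CW Wy nWx]]; exists W; split=> //.
  by have [_ _ _ divW] := satC CW; apply: divW hb Wy.
Qed.

Lemma strictly_below_mul x a :
  x != 0 -> strictly_below x (g a * x) -> h a = 0.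
Proof.
move=> nzx [W [CW Wax nWx]]; apply/eqP; apply: contra_notT nWx => ha.
by have [_ _ _ divW] := satC CW; apply: divW ha Wax.
Qed.

(** The submodule [strictly_below x + I x] over the localisation, with the denominator [t]
    cleared. *)
Definition multiples_mod (I : B -> Prop) (x y : K) :=
  exists t a, [/\ h t != 0, I a & strictly_below x (g t * y - g a * x)].

(** Nothing in the chain lies strictly between [strictly_below x] and the smallest member containing
    [x], so this submodule is comparable with every member and maximality applies. *)
Lemma multiples_mod_chain (I : B -> Prop) x : x != 0 ->
  I 0 -> (forall a b, I a -> I b -> I (a + b)) -> (forall r a, I a -> I (r * a)) ->
  C (multiples_mod I x).
Proof.
move=> nzx I0 ID IM.
have satV := saturated_strictly_below nzx; have [V0 VD VM VS] := satV.
case: maxC => _; apply.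
  split.
  - exists 1, 0; split=> //; first by rewrite rmorph1 oner_neq0.
    by rewrite mulr0 rmorph0 mul0r subr0.
  - move=> y1 y2 [t1 [a1 [ht1 Ia1 V1]]] [t2 [a2 [ht2 Ia2 V2]]].
    exists (t1 * t2), (t2 * a1 + t1 * a2); split.
    + by rewrite rmorphM mulf_neq0.
    + by apply: ID; apply: IM.
    + have := VD _ _ (VM t2 _ V1) (VM t1 _ V2); congr strictly_below.
      by rewrite rmorphD !rmorphM; ring.
  - move=> b y [t [a [ht Ia V]]]; exists t, (b * a); split=> //; first exact: IM.
    have := VM b _ V; congr strictly_below; rewrite !rmorphM; ring.
  - move=> b y hb [t [a [ht Ia V]]]; exists (t * b), a; split=> //.
      by rewrite rmorphM mulf_neq0.
    by move: V; congr strictly_below; rewrite rmorphM; ring.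
move=> W CW; have [Wx|nWx] := pselect (W x); [right|left] => y.
  move=> [t [a [ht Ia V]]]; have [_ WD WM WS] := satC CW.
  apply: (WS t) => //; rewrite -[g t * y](subrK (g a * x)).
  by apply: WD; [apply: strictly_below_sub V _ | apply: WM].
move=> Wy; exists 1, 0; split=> //; first by rewrite rmorph1 oner_neq0.
by rewrite rmorph1 mul1r rmorph0 mul0r subr0; exists W.
Qed.

(** A Nakayama argument: the chain contains [strictly_below y + (ker h) y], and [y] is not in it,
    since otherwise an element outside [ker h] would multiply [y] strictly below itself. *)
Lemma kernel_mul_strictly_below x y a :
  x != 0 -> same_level x y -> h a = 0 -> strictly_below x (g a * y).
Proof.
move=> nzx [xy yx] ha; have [V0 VD VM VS] := saturated_strictly_below nzx.
have nzy : y != 0.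
  apply/eqP => y0; case: (strictly_below0 nzx) => W [CW W0 nWx].
  by apply: nWx; apply: yx => //; rewrite y0.
apply: (@strictly_below_level y) => //.
exists (multiples_mod (fun a => h a = 0) y); split.
- apply: multiples_mod_chain => //; first exact: rmorph0.
    by move=> b c hb hc; rewrite rmorphD hb hc addr0.
  by move=> r b hb; rewrite rmorphM hb mulr0.
- exists 1, a; split=> //; first by rewrite rmorph1 oner_neq0.
  by rewrite rmorph1 mul1r subrr; apply: strictly_below0.
- move=> [t [b [ht hb]]]; rewrite -mulrBl -rmorphB => /strictly_below_mul.
  by move=> /(_ nzy) /eqP; rewrite rmorphB hb subr0 (negbTE ht).
Qed.

(** The chain member [strictly_below x + B x] contains [x], hence [y]; it remains to remove the
    denominator. *)
Lemma leading_digit x y : x != 0 -> same_level x y ->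
  exists a, strictly_below x (y - g a * x).
Proof.
move=> nzx xy; have [V0 VD VM VS] := saturated_strictly_below nzx.
have : multiples_mod xpredT x y.
  apply: xy.1; first exact: multiples_mod_chain.
  exists 1, 1; split=> //; first by rewrite rmorph1 oner_neq0.
  by rewrite subrr.
move=> [t [a [ht _ V]]].
(* The inverse of [h t] must be the image of an element of [B]; in a finite field it is a power of
   [h t]. *)
have [s hst] : exists s, h (s * t) = 1.
  exists (t ^+ #|F|.-2); apply: (mulfI ht).
  by rewrite mulr1 -exprSr rmorphXn -exprS -addn2 -subn2 subnK ?finNzRing_gt1 ?expf_card.
exists (s * a).
have := VD _ _ (VM s _ V) (@kernel_mul_strictly_below x y (1 - s * t) nzx xy _).
rewrite rmorphB hst rmorph1 subrr => /(_ erefl); congr strictly_below.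
by rewrite rmorphB rmorph1 !rmorphM; ring.
Qed.

Lemma same_level_refl x : same_level x x. Proof. by split. Qed.

Lemma same_level_sym x y : same_level x y -> same_level y x.
Proof. by case. Qed.

Lemma same_level_trans x y z : same_level x y -> same_level y z -> same_level x z.
Proof.
by move=> [xy yx] [yz zy]; split; [apply: weakly_below_trans xy yz|
  apply: weakly_below_trans zy yx].
Qed.

Lemma same_level_neq0 x y : x != 0 -> same_level x y -> y != 0.
Proof.
move=> nzx [_ yx]; apply/eqP => y0; have [W [CW W0 nWx]] := strictly_below0 nzx.
by apply: nWx; apply: yx => //; rewrite y0.
Qed.

Lemma level_representative : exists e : K -> K,
  (forall x, same_level x (e x)) /\
  (forall x y, same_level x y -> e x = e y).
Proof.
exists (fun x => xget 0 (same_level x)); split=> [x|x y xy].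
  by apply: (@xgetPex _ 0 (same_level x)); exists x; split.
congr xget; apply/seteqP; split=> z; apply: same_level_trans => //.
exact: same_level_sym.
Qed.

Lemma sum_saturated W (I : finType) (P : pred I) (x : I -> K) :
  saturated W -> (forall i, P i -> W (x i)) -> W (\sum_(i | P i) x i).
Proof. by case=> W0 WD _ _ Wx; apply: big_ind. Qed.

(* The colour of [x] is the residue of its leading digit relative to the chosen
   representative of its level. *)
Lemma leading_digit_colouring : exists chi : K -> F,
  (forall x, (chi x == 0) = (x == 0)) /\
  forall (I : finType) (x : I -> K) (b : I -> B) (i0 : I),
    (forall i, x i != 0) -> (forall i j, chi (x i) = chi (x j)) ->
    \sum_i g (b i) * x i = 0 ->
    (forall j, ~ weakly_below (x i0) (x j) -> g (b j) = 0) ->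
    h (\sum_(j | `[< same_level (x i0) (x j) >]) b j) = 0.
Proof.
have [e [e_level e_eq]] := level_representative.
have e_neq0 x : x != 0 -> e x != 0 by move/same_level_neq0; apply.
have [a aP] : exists a : K -> B,
    forall x, x != 0 -> strictly_below (e x) (x - g (a x) * e x).
  suff /choice[a ?] : forall x, exists a,
      x != 0 -> strictly_below (e x) (x - g a * e x) by exists a.
  move=> x; have [->|nzx] := eqVneq x 0; first by exists 0.
  have [b ?] := leading_digit (e_neq0 x nzx) (same_level_sym (e_level x)).
  by exists b.
have nz_ha x : x != 0 -> h (a x) != 0.
  move=> nzx; apply/eqP => ha; have nzex := e_neq0 x nzx.
  have [_ VD VM _] := saturated_strictly_below nzex.
  have := VD _ _ (aP x nzx) (kernel_mul_strictly_below nzex (same_level_refl _) ha).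
  rewrite subrK.
  by move=> /strictly_belowP; apply; case: (e_level x).
(* The colour 0 is free for the element 0, as leading digits of nonzero elements have nonzero
   residue. *)
exists (fun x => if x == 0 then 0 else h (a x)); split=> [x|].
  by have [_|nzx] := eqVneq x 0; [rewrite eqxx | apply/negbTE/nz_ha].
move=> I x b i0 nzx mono sum0 high0.
set e0 := e (x i0); set al := a (x i0).
have nze0 : e0 != 0 by apply: e_neq0.
have satV := saturated_strictly_below nze0; have [V0 VD VM VS] := satV.
have same_e j : same_level (x i0) (x j) -> e (x j) = e0.
  by move/e_eq.
(* Equal colours make the digits differ by an element of [ker h], so the single digit [al] serves
   the whole level. *)
have digit j : same_level (x i0) (x j) -> strictly_below e0 (x j - g al * e0).
  move=> lev; have := aP _ (nzx j); rewrite same_e // => V1.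
  have ha : h (a (x j) - al) = 0.
    move: (mono j i0); rewrite (negbTE (nzx j)) (negbTE (nzx i0)) => haj.
    by rewrite rmorphB /= haj subrr.
  have := VD _ _ V1 (kernel_mul_strictly_below nze0 (same_level_refl _) ha).
  by congr strictly_below; rewrite rmorphB; ring.
have other j : ~~ `[< same_level (x i0) (x j) >] ->
    strictly_below e0 (g (b j) * x j).
  move/asboolPn => nlev; have [lo|/high0->] := pselect (weakly_below (x i0) (x j)).
    apply: VM; apply: strictly_below_level (e_level (x i0)) _.
    have [up|//] := weakly_below_total (x j) (x i0).
    by case: nlev.
  by rewrite mul0r.
(* Modulo [strictly_below e0] only the terms of this level remain in the vanishing sum, each with
   [x j] replaced by [g al * e0]. *)
have : strictly_below e0 (g ((\sum_(j | `[< same_level (x i0) (x j) >]) b j) * al) * e0).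
  have Vother := sum_saturated satV other.
  have Vdigit : strictly_below e0 (\sum_(j | `[< same_level (x i0) (x j) >])
      g (b j) * (x j - g al * e0)).
    by apply: sum_saturated => // j /asboolP lev; apply/VM/digit.
  have := saturated_opp satV (VD _ _ Vother Vdigit); congr strictly_below.
  have sumE : 0 = \sum_(j | `[< same_level (x i0) (x j) >]) g (b j) * x j +
      \sum_(j | ~~ `[< same_level (x i0) (x j) >]) g (b j) * x j.
    by rewrite -[LHS]sum0 [LHS](bigID (fun j => `[< same_level (x i0) (x j) >])).
  have -> : \sum_(j | `[< same_level (x i0) (x j) >]) g (b j) * (x j - g al * e0) =
      \sum_(j | `[< same_level (x i0) (x j) >]) g (b j) * x j -
      g ((\sum_(j | `[< same_level (x i0) (x j) >]) b j) * al) * e0.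
    under eq_bigr do rewrite mulrBr.
    rewrite sumrB -mulr_suml [in RHS]rmorphM rmorph_sum /=.
    by rewrite -[in RHS]mulrA.
  by rewrite addrA [X in X - _]addrC -sumE sub0r opprK.
move/(strictly_below_mul nze0)/eqP; rewrite rmorphM mulf_eq0.
by rewrite [h al == 0](negbTE (nz_ha _ (nzx i0))) orbF => /eqP.
Qed.

End LeadingDigit.

(** * Rado's theorem over a field *)

(** The number [v i] of elements strictly below [i] represents the preorder; its index in the sorted
    list of values makes the ranks consecutive. *)
Lemma ranking (l : nat) (le : rel 'I_l) : (0 < l)%N ->
  total le -> transitive le ->
  exists (m : nat) (f : 'I_l -> 'I_m.+1),
    (forall t, exists i, f i = t) /\ forall i j, le i j = (f i <= f j)%N.
Proof.
move=> l_gt0 le_tot le_tr.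
have le_refl i : le i i by have := le_tot i i; rewrite orbb.
pose v i := #|[set j | ~~ le i j]|.
have leE i j : le i j = (v i <= v j)%N.
  apply/idP/idP => [lij|].
    apply/subset_leq_card/fintype.subsetP => x; rewrite !inE.
    by apply: contra; apply: le_tr.
  apply: contraTT => nlij; rewrite -ltnNge; apply: proper_card.
  have lji : le j i by have := le_tot i j; rewrite (negbTE nlij).
  apply/fintype.properP; split.
    by apply/fintype.subsetP => x; rewrite !inE; apply: contra; apply: le_tr.
  by exists j; rewrite !inE ?le_refl.
pose s := sort leq (undup [seq v i | i <- enum 'I_l]).
have vs i : v i \in s by rewrite mem_sort mem_undup map_f // mem_enum.
have s_ltn : sorted ltn s.
  by rewrite ltn_sorted_uniq_leq sort_uniq undup_uniq sort_sorted //; apply: leq_total.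
have s_gt0 : (0 < size s)%N.
  by have := vs (Ordinal l_gt0); rewrite -index_mem; apply: leq_trans.
have idx i : (index (v i) s < (size s).-1.+1)%N by rewrite prednK // index_mem.
exists (size s).-1, (fun i => Ordinal (idx i)); split.
  move=> t; have tlt : (t < size s)%N by apply: leq_trans (ltn_ord t) _; rewrite prednK.
  have : nth 0%N s t \in s by rewrite mem_nth.
  rewrite {2}/s mem_sort mem_undup => /mapP[i _ vi]; exists i; apply: val_inj => /=.
  by rewrite -vi index_uniq //; apply: (sorted_uniq ltn_trans ltnn).
move=> i j /=; rewrite leE.
have s_leq : sorted leq s by apply: sub_sorted s_ltn => x y /ltnW.
apply/idP/idP; last exact: (sorted_leq_index leq_trans leqnn).
by apply: contraTT; rewrite -!ltnNge; apply: (sorted_ltn_index ltn_trans s_ltn).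
Qed.

(** A vector outside a span is detected by a column of the cokernel matrix. The functional [u] turns
    a failing columns condition into one scalar equation. *)
Lemma span_or_functional (K : fieldType) (k l : nat) (A : 'I_k -> 'I_l -> K)
    (J I : {set 'I_l}) :
  (exists a : 'I_l -> K, forall i,
     \sum_(j in I) A i j = \sum_(j in J) a j * A i j) \/
  (exists u : 'I_k -> K, (forall j, j \in J -> \sum_i u i * A i j = 0) /\
     \sum_(j in I) \sum_i u i * A i j != 0).
Proof.
pose M : 'M[K]_(l, k) := \matrix_(j, i) if j \in J then A i j else 0.
pose v : 'rV[K]_k := \row_i \sum_(j in I) A i j.
have [/submxP[a va]|nsub] := boolP (v <= M)%MS; [left|right].
  exists (fun j => a 0 j) => i; have := congr1 (fun w : 'rV_k => w 0 i) va.
  rewrite !mxE => ->; rewrite [RHS]big_mkcond; apply: eq_bigr => j _.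
  by rewrite mxE; case: ifP => // _; rewrite mulr0.
move: nsub; rewrite submxE => /rV0Pn[c nzc]; exists (fun i => cokermx M i c); split=> [j Jj|].
  have := congr1 (fun N : 'M_(l, k) => N j c) (mulmx_coker M).
  rewrite !mxE => M0; rewrite -[RHS]M0; apply: eq_bigr => i _.
  by rewrite [M j i]mxE Jj mulrC.
suff -> : \sum_(j in I) \sum_i cokermx M i c * A i j = (v *m cokermx M) 0 c by [].
rewrite exchange_big mxE. apply: eq_bigr => i _.
by rewrite [v 0 i]mxE -mulr_sumr mulrC.
Qed.

Lemma field_columns_colouring (K : fieldType) (k l : nat) (A : 'I_k -> 'I_l -> K) :
  exists (F : finType) (chi : K -> F), (forall x, chi x = chi 0 -> x = 0) /\
    forall x : 'I_l -> K, (exists i, x i != 0) ->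
    (forall i, \sum_j A i j * x j = 0) -> (forall i j, chi (x i) = chi (x j)) ->
    exists (m : nat) (f : 'I_l -> 'I_m.+1), (forall t, exists i, f i = t) /\
      forall t, exists a : 'I_l -> K, forall i,
        \sum_(j | f j == t) A i j = \sum_(j | (f j < t)%N) a j * A i j.
Proof.
have [u uP] : exists u : {set 'I_l} * {set 'I_l} -> 'I_k -> K,
    forall JI : {set 'I_l} * {set 'I_l},
    (exists a : 'I_l -> K, forall i,
       \sum_(j in JI.2) A i j = \sum_(j in JI.1) a j * A i j) \/
    ((forall j, j \in JI.1 -> \sum_i u JI i * A i j = 0) /\
       \sum_(j in JI.2) \sum_i u JI i * A i j != 0).
  suff /choice[u ?] : forall JI : {set 'I_l} * {set 'I_l}, exists u : 'I_k -> K,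
      (exists a : 'I_l -> K, forall i,
         \sum_(j in JI.2) A i j = \sum_(j in JI.1) a j * A i j) \/
      ((forall j, j \in JI.1 -> \sum_i u i * A i j = 0) /\
         \sum_(j in JI.2) \sum_i u i * A i j != 0) by exists u.
  move=> [J I]; have [?|[u ?]] := span_or_functional A J I; last by exists u; right.
  by exists (fun=> 0); left.
pose w JI j : K := \sum_i u JI i * A i j.
(* All partial sums, for all pairs of sets, are listed because the colouring must be fixed before
   the solution and its partition are known. Singletons give the coefficients themselves. *)
pose part_sum (p : {set 'I_l} * {set 'I_l} * {set 'I_l}) := \sum_(j in p.2) w p.1 j.
pose xs := [seq part_sum p | p <- enum {: {set 'I_l} * {set 'I_l} * {set 'I_l}}].
have xsP JI (S : {set 'I_l}) : \sum_(j in S) w JI j \in xs.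
  by apply/mapP; exists (JI, S); rewrite ?mem_enum.
have [B [g [F [h [ker_gh lift]]]]] := finField_specialization xs.
have [b bP] : exists b : K -> B, forall x, x \in xs -> g (b x) = x.
  suff /choice[b ?] : forall x, exists b, x \in xs -> g b = x by exists b.
  move=> x; have [/lift[b [<- _]]|] := boolP (x \in xs); first by exists b.
  by exists 0.
have [C maxC] := maximal_chain_exists g h.
have [chi [chi0 chiP]] := leading_digit_colouring ker_gh maxC.
exists F, chi; split=> [x|x [i0 nz_i0] Ax0 mono].
  have /eqP -> : chi 0 == 0 by rewrite chi0.
  by move/eqP; rewrite chi0 => /eqP.
have nzx i : x i != 0 by rewrite -chi0 (mono i i0) chi0.
have l_gt0 : (0 < l)%N by case: (i0) => i; apply: leq_trans.
(* Class 0 collects the entries of the highest level in the chain, and later classes lie lower. *)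
have [||m [f [f_surj fP]]] := @ranking l (fun i j => `[< weakly_below C (x i) (x j) >]) l_gt0.
- move=> i j; apply/orP.
  have [|W] := weakly_below_total C (x i) (x j); first by left; apply/asboolP.
  by right; apply/asboolP; apply: (strictly_weakly_below maxC).
- by move=> j i s /asboolP ij /asboolP js; apply/asboolP; apply: weakly_below_trans ij js.
exists m, f; split=> // t; have [i1 fi1] := f_surj t.
pose J := [set j | (f j < t)%N]; pose S := [set j | f j == t].
have sumJ (G : 'I_l -> K) : \sum_(j in J) G j = \sum_(j | (f j < t)%N) G j.
  by apply: eq_bigl => j; rewrite inE.
have sumS (V : nmodType) (G : 'I_l -> V) : \sum_(j in S) G j = \sum_(j | f j == t) G j.
  by apply: eq_bigl => j; rewrite inE.
have [[a aP]|[wJ wS]] := uP (J, S).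
  by exists a => i; rewrite -sumS -sumJ aP.
have gb j : g (b (w (J, S) j)) = w (J, S) j.
  by apply: bP; have := xsP (J, S) [set j]; rewrite big_set1.
have h0 : h (\sum_(j | `[< same_level C (x i1) (x j) >]) b (w (J, S) j)) = 0.
  apply: (chiP 'I_l x (fun j => b (w (J, S) j))) => // [|j nbelow].
    under eq_bigr do rewrite gb mulr_suml.
    rewrite exchange_big /= big1 // => i _.
    transitivity (u (J, S) i * \sum_j A i j * x j); last by rewrite Ax0 mulr0.
    by rewrite mulr_sumr; apply: eq_bigr => j _; rewrite mulrA.
  by rewrite gb; apply: wJ; rewrite inE -fi1 ltnNge -fP; apply/asboolPn.
(* The lift [c] of the nonzero sum has nonzero residue, yet it agrees under [g], hence under [h],
   with the sum of lifts that the colouring forces to residue zero. *)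
have [c [gc /(_ wS)]] := lift _ (xsP (J, S) S).
case/eqP; apply/eqP; rewrite -subr_eq0 -[in X in _ - X]h0 -rmorphB.
apply/eqP/ker_gh; rewrite rmorphB rmorph_sum gc; apply/eqP; rewrite subr_eq0.
apply/eqP; apply: eq_big => [j|j _]; last by rewrite /= gb.
rewrite inE -fi1 -(inj_eq val_inj) eqn_leq -!fP andbC.
by apply/andP/asboolP => -[]; [move=> /asboolP ? /asboolP ?|split; apply/asboolP].
Qed.

(** * Residue fields and noetherian ideals *)

Lemma fractionE (Q : idomainType) (z : {fraction Q}) :
  exists a b, b != 0 /\ z * tofrac b = tofrac a.
Proof.
elim/(@quotW _ (FracField.type Q)): z => r.
exists (\n_r), (\d_r); split; first exact: denom_ratioP.
unlock tofrac; rewrite -[LHS]FracField.pi_mul; apply/eqmodP => /=.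
rewrite FracField.equivfE /FracField.mulf /=.
rewrite !numden_Ratio ?mulf_neq0 ?denom_ratioP ?oner_neq0 //.
by rewrite !mulr1 mulrC.
Qed.

(** The inverse operation that an [idomainType] carries is obtained by choice. *)
Lemma fraction_field (Q : comNzRingType) :
  (forall x y : Q, x * y = 0 -> (x == 0) || (y == 0)) ->
  exists (K : fieldType) (i : {rmorphism Q -> K}),
    (forall x, i x = 0 -> x = 0) /\
    forall z, exists a b, b != 0 /\ z * i b = i a.
Proof.
move=> idQ.
have [inv invP] : exists inv : Q -> Q, forall x,
    (exists y, y * x = 1) /\ inv x * x = 1 \/ ~ (exists y, y * x = 1) /\ inv x = x.
  suff /choice[inv ?] : forall x : Q, exists v,
    (exists y, y * x = 1) /\ v * x = 1 \/ ~ (exists y, y * x = 1) /\ v = x by exists inv.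
  move=> x; have [[v vx]|nv] := pselect (exists y, y * x = 1).
    by exists v; left; split=> //; exists v.
  by exists x; right.
pose u : {pred Q} := fun x => `[< exists y, y * x = 1 >].
have mulVx : {in u, left_inverse 1 inv *%R}.
  by move=> x /asboolP ux; case: (invP x) => -[].
have unitPl x y : y * x = 1 -> u x by move=> yx; apply/asboolP; exists y.
have invr_out : {in [predC u], inv =1 id}.
  by move=> x /asboolP nux; case: (invP x) => -[].
pose D1 := GRing.ComNzRing_hasMulInverse.Build Q mulVx unitPl invr_out.
pose Q1 : comUnitRingType := HB.pack (Q : Type) Q D1.
pose Q2 : idomainType := HB.pack (Q : Type) Q1 (GRing.ComUnitRing_isIntegral.Build Q1 idQ).
exists {fraction Q2}, (@tofrac Q2 : {rmorphism Q2 -> {fraction Q2}}).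
split=> [x /eqP|z]; first by rewrite tofrac_eq0 => /eqP.
by have [a [b [nzb zb]]] := @fractionE Q2 z; exists a, b.
Qed.

Lemma residue_field (R : comPzRingType) (p : R -> Prop) : prime_ideal p ->
  exists (K : fieldType) (pi : {rmorphism R -> K}),
    (forall x, pi x = 0 <-> p x) /\
    forall z, exists a b, ~ p b /\ z * pi b = pi a.
Proof.
move=> [[p0 pD pM] np1 p_prime].
have nz1 : (1 : R) != 0 by apply: contra_not_neq np1 => ->.
pose R1 : comNzRingType := HB.pack (R : Type) R (GRing.PzSemiRing_isNonZero.Build R nz1).
pose I : {pred R1} := fun x => `[< p x >].
have I_closed : idealr_closed I.
  split=> [||a u v /asboolP pu /asboolP pv]; [exact/asboolP|exact/asboolPn|].
  by apply/asboolP/pD => //; apply: pM.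
have I_prime : prime_idealr_closed I.
  move=> u v /asboolP /p_prime puv; apply/orP.
  by case: puv => ?; [left|right]; apply/asboolP.
pose I1 : idealr R1 := HB.pack I (isIdealr.Build R1 I I_closed).
pose I2 : prime_idealr R1 := HB.pack I I1 (isPrimeIdealrClosed.Build R1 I I_prime).
have [K [i [i_inj iP]]] := fraction_field (@Quotient.rquot_IdomainAxiom R1 I2).
pose q : {rmorphism R1 -> {ideal_quot I2}} := \pi_({ideal_quot I2})%qT.
have q0 x : q x = 0 <-> p x.
  have -> : (q x = 0) <-> (x - 0 \in I2).
    rewrite (Quotient.idealrBE I2); split=> [qx|/eqP].
      by apply/eqP; rewrite -[LHS]/(q x) qx -[RHS]/(q 0) rmorph0.
    by rewrite -[LHS]/(q x) -[RHS]/(q 0) rmorph0.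
  by rewrite subr0; split=> [/asboolP|?]; last apply/asboolP.
exists K, (i \o q : {rmorphism R1 -> K}); split=> [x|z].
  by rewrite -q0 /=; split=> [/i_inj|->]; rewrite ?rmorph0.
have [a [b [nzb zb]]] := iP z; exists (repr a), (repr b).
have qr c : q (repr c) = c by apply: reprK.
split; last by rewrite /= !qr.
by rewrite -q0 qr; apply/eqP.
Qed.

(** * Ideals of noetherian rings *)

Section Ideals.
Variable R : comPzRingType.
Implicit Types (I J N p : R -> Prop) (s : seq R).

Lemma is_idealB I x y : is_ideal I -> I x -> I y -> I (x - y).
Proof. by case=> _ ID IM Ix Iy; rewrite -mulN1r; apply/ID/IM. Qed.

Lemma ann_ideal (c : R) : is_ideal (ann c).
Proof.
rewrite /ann; split=> [|x y xc yc|r x xc]; first exact: mul0r.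
  by rewrite mulrDl xc yc addr0.
by rewrite -mulrA xc mulr0.
Qed.

(** Without a maximal member, choice would produce a strictly increasing sequence of ideals. *)
Lemma noetherian_maximal (Phi : (R -> Prop) -> Prop) : noetherian_ring R ->
  (forall I, Phi I -> is_ideal I) -> (exists I, Phi I) ->
  exists2 I, Phi I &
    forall J, Phi J -> (forall x, I x -> J x) -> forall x, J x -> I x.
Proof.
move=> noethR ideal_Phi [I0 PhiI0]; apply: contrapT => nomax.
have [next nextP] : exists next : (R -> Prop) -> (R -> Prop), forall I, Phi I ->
    [/\ Phi (next I), forall x, I x -> next I x & exists x, next I x /\ ~ I x].
  suff /choice[next ?] : forall I, exists J, Phi I ->
    [/\ Phi J, forall x, I x -> J x & exists x, J x /\ ~ I x] by exists next.
  move=> I; have [PhiI|nPhi] := pselect (Phi I); last by exists I.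
  apply: contrapT => noJ; apply: nomax; exists I => // J PhiJ IJ x Jx.
  by apply: contrapT => nIx; apply: noJ; exists J => _; split=> //; exists x.
pose chain n := iter n next I0.
have PhiC n : Phi (chain n) by elim: n => //= n /nextP[].
have [N stable] := noethR chain (fun n => ideal_Phi _ (PhiC n))
  (fun n => let: And3 _ sub _ := nextP _ (PhiC n) in sub).
have [_ _ [x [nx]]] := nextP _ (PhiC N); apply.
by apply/(stable N.+1 (leqnSn N)).
Qed.

(** Encoded as an intersection of ideals, so that consequences follow by instantiating one ideal,
    without linear combinations. *)
Definition ideal_span s : R -> Prop :=
  fun x => forall I, is_ideal I -> (forall y, y \in s -> I y) -> I x.

Lemma ideal_span_ideal s : is_ideal (ideal_span s).
Proof.
split=> [I [] //|x y sx sy I idI sI|r x sx I idI sI]; case: (idI) => _ ID IM.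
  by apply: ID; [apply: sx | apply: sy].
by apply: IM; apply: sx.
Qed.

Lemma mul_ideal_span0 s e x :
  (forall y, y \in s -> e * y = 0) -> ideal_span s x -> e * x = 0.
Proof.
move=> es /(_ (fun y => e * y = 0)); apply=> //.
split=> [|y z|r y]; rewrite ?mulr0 // ?mulrDr; first by move=> -> ->; rewrite addr0.
by rewrite mulrCA => ->; rewrite mulr0.
Qed.

(** A maximal span of a finite list from [G] absorbs every further element of [G]. As [G] is any
    set, the generators can be taken among special elements. *)
Lemma noetherian_finite_span (G : R -> Prop) : noetherian_ring R ->
  exists s, (forall y, y \in s -> G y) /\ forall x, G x -> ideal_span s x.
Proof.
move=> noethR.
have [||I [s [Gs ->]] maxs] := @noetherian_maximal
  (fun I => exists s, (forall y, y \in s -> G y) /\ I = ideal_span s) noethR.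
- by move=> I [s [_ ->]]; apply: ideal_span_ideal.
- by exists (ideal_span [::]), [::].
exists s; split=> // x Gx; apply: (maxs (ideal_span (x :: s))).
- exists (x :: s); split=> // y; rewrite inE => /predU1P[-> //|]; exact: Gs.
- move=> y sy I' idI' sI'; apply: sy => // z sz.
  by apply: sI'; rewrite inE sz orbT.
- by move=> I' _; apply; rewrite mem_head.
Qed.

Definition finite_mod p := exists s, forall x, exists2 y, y \in s & p (x - y).

Lemma finite_mod_colouring p (C : finType) (f : R -> C) :
  (forall x y, f x = f y -> p (x - y)) -> finite_mod p.
Proof.
move=> fp; have [v vP] : exists v : C -> R, forall c, (exists x, f x = c) -> f (v c) = c.
  suff /choice[v ?] : forall c, exists y, (exists x, f x = c) -> f y = c by exists v.
  move=> c; have [[x fx]|nx] := pselect (exists x, f x = c); first by exists x.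
  by exists 0.
exists [seq v c | c <- enum C] => x; exists (v (f x)).
  by rewrite map_f // mem_enum.
by apply: fp; rewrite vP //; exists x.
Qed.

(** Modulo its annihilator, [R] acts faithfully on the finite set [N], which has only finitely many
    self-maps. *)
Lemma finite_annihilator p N : is_ideal p -> finite_subset N -> is_ideal N ->
  (forall z, (forall y, N y -> z * y = 0) -> p z) -> finite_mod p.
Proof.
move=> idp [s sN] [_ _ NM] annp; pose s' := [seq x <- s | `[< N x >]].
have s'P y : N y <-> y \in s'.
  by rewrite mem_filter; split=> [Ny|/andP[/asboolP]//]; rewrite sN // andbT; apply/asboolP.
pose f (x : R) := [ffun i : 'I_(size s') => inord (index (x * s'`_i) s') : 'I_(size s').+1].
apply: (@finite_mod_colouring _ _ f) => x y fxy; apply: annp => z /[dup] Nz /s'P s'z.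
have iz : (index z s' < size s')%N by rewrite index_mem.
have /(congr1 val) : f x (Ordinal iz) = f y (Ordinal iz) by rewrite fxy.
have idx (w : R) : (index (w * z)%R s' < (size s').+1)%N by rewrite ltnS index_size.
rewrite !ffunE /= nth_index // !inordK // => /index_inj.
have zs (w : R) : w * z \in s' by apply/s'P/NM.
by move=> /(_ 0 (zs _) (zs _)) xz; rewrite mulrBl xz subrr.
Qed.

(* A maximal finite subideal [I0] is everything: the largest colon ideal
   [(I0 : n)] is prime, and it is either the annihilator of an element of [N]
   or contains the annihilator of the finite ideal [I0]; in both cases
   [I0 + R n] is finite. *)
Lemma finite_ideal N : noetherian_ring R -> is_ideal N ->
  (forall n, N n -> prime_ideal (ann n) -> finite_mod (ann n)) ->
  finite_subset N.
Proof.
move=> noethR idN primeN; have [N0 ND NM] := idN.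
have [I [idI _ _] //||I0 [idI0 I0N finI0] maxI0] := @noetherian_maximal
  (fun I => [/\ is_ideal I, (forall x, I x -> N x) & finite_subset I]) noethR.
  exists (fun x => x = 0); split=> [|x -> //|].
    by split=> [//|x y -> ->|r x ->]; rewrite ?addr0 ?mulr0.
  by exists [:: 0] => x ->; rewrite mem_head.
apply: contrapT => infN.
have [n0 [Nn0 nI0n0]] : exists n, N n /\ ~ I0 n.
  apply: contrapT => noN; apply: infN; have [s sI0] := finI0; exists s => x Nx.
  by apply: sI0; apply: contrapT => nI0x; apply: noN; exists x.
have [I00 I0D I0M] := idI0.
have colon_ideal n : is_ideal (fun x => I0 (x * n)).
  split=> [|x y|r x]; first by rewrite mul0r.
    by rewrite mulrDl; apply: I0D.
  by rewrite -mulrA; apply: I0M.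
have [J [n [_ _ ->]] //||q [n [Nn nI0n defq]] maxq] := @noetherian_maximal
  (fun J => exists n, [/\ N n, ~ I0 n & J = fun x => I0 (x * n)]) noethR.
  by exists (fun x => I0 (x * n0)), n0.
have q_larger m : N m -> ~ I0 m -> (forall x, q x -> I0 (x * m)) ->
    forall x, I0 (x * m) -> q x.
  by move=> Nm nI0m; apply: (maxq (fun x => I0 (x * m))); exists m.
have idq : is_ideal q by rewrite defq.
have q_prime : prime_ideal q.
  split=> // [|a b qab]; first by rewrite defq mul1r.
  have [|nqa] := pselect (q a); [by left | right].
  apply: (q_larger (a * n)); first exact: NM.
  - by move: nqa; rewrite defq.
  - by move=> x; rewrite defq mulrCA; apply: I0M.
  - by rewrite mulrA [b * a]mulrC; move: qab; rewrite defq.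
have [t tP] : finite_mod q.
  have [[z [nqz zI0]]|nz] := pselect (exists z, ~ q z /\ forall y, I0 y -> z * y = 0).
    (* Since [z] kills [I0], which contains [q n], it kills [q n]; the converse uses that [q] is
       prime and [z] is outside it. *)
    suff qE : q = ann (z * n).
      by rewrite qE; apply: primeN; [apply: NM | rewrite -qE].
    have [_ _ q_or] := q_prime.
    apply/funext => x; apply/propext; rewrite /ann mulrCA; split=> [qx|zxn].
      by apply: zI0; move: qx; rewrite defq.
    have : q (x * z) by rewrite defq -mulrA mulrCA zxn.
    by case/q_or.
  apply: (finite_annihilator idq finI0 idI0) => z zI0.
  by apply: contrapT => nqz; apply: nz; exists z.
pose I1 x := exists r i, I0 i /\ x = i + r * n.
apply: nI0n; apply: (maxI0 I1); last first.
- by exists 1, 0; rewrite mul1r add0r.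
- by move=> x I0x; exists 0, x; rewrite mul0r addr0.
split.
- split=> [|x y [r [i [Ii ->]]] [r' [i' [Ii' ->]]]|a x [r [i [Ii ->]]]].
  + by exists 0, 0; rewrite mul0r addr0.
  + by exists (r + r'), (i + i'); split; [apply: I0D | rewrite mulrDl addrACA].
  + by exists (a * r), (a * i); split; [apply: I0M | rewrite mulrDr mulrA].
- by move=> x [r [i [/I0N Ni ->]]]; apply: ND => //; apply: NM.
- have [s sI0] := finI0; exists [seq i + y * n | i <- s, y <- t] => x [r [i [Ii ->]]].
  have [y ty qry] := tP r; apply/allpairsP; exists (i + (r - y) * n, y).
  split=> //=; last by rewrite -addrA -mulrDl subrK.
  by apply: sI0; apply: I0D => //; move: qry; rewrite defq.
Qed.

(** An element of [p] cannot become invertible in [R_p], so it becomes zero there; the product of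
    the multipliers killing the generators kills [p]. *)
Lemma localisation_field_annihilator p s : prime_ideal p ->
  (forall y, y \in s -> p y) -> (forall x, p x -> ideal_span s x) ->
  localisation_is_field p -> exists2 u, ~ p u & forall x, p x -> u * x = 0.
Proof.
move=> [[p0 pD pM] np1 p_prime] sp ps [_ p_field].
have kill a : p a -> exists2 u, ~ p u & u * a = 0.
  move=> pa; apply: contrapT => nokill.
  have [|b [t [u [npt npu]]]] := p_field a 1 np1.
    by case=> u [npu ua]; apply: nokill; exists u.
  rewrite mul1r mulrBr => /eqP; rewrite subr_eq0 => /eqP uab.
  suff : p (u * t) by case/p_prime.
  by rewrite -uab mulrCA mulrC; apply: pM.
suff [u npu us] : exists2 u, ~ p u & forall y, y \in s -> u * y = 0.
  by exists u => // x /ps; apply: mul_ideal_span0.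
have {ps} : forall y, y \in s -> p y by [].
elim: s {sp} => [|a s IHs] sp; first by exists 1.
have [u npu us] := IHs (fun y sy => sp y (mem_behead (s := a :: s) sy)).
have [v npv va] := kill a (sp a (mem_head _ _)).
exists (u * v); first by move=> /p_prime[].
by move=> y /predU1P[->|/us uy]; rewrite -mulrA ?va ?mulr0 // mulrCA uy mulr0.
Qed.

End Ideals.

(** * Sufficiency *)

Section Forced.
Variables (R : comPzRingType) (k l : nat) (A : 'M[R]_(k, l)).

(** For a single class the infinitude clause is vacuous. *)
Lemma constant_solution_columns (d : R) : (0 < l)%N -> d != 0 ->
  (forall i, d * \sum_j A i j = 0) -> generalised_columns_condition A.
Proof.
move=> l_gt0 nzd dA; exists 0%N, (fun=> ord0), (fun=> d); split=> //.
- by move=> t; exists (Ordinal l_gt0); rewrite [RHS]ord1.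
- apply/matrixP => i j; rewrite !mxE summxE -[RHS](dA i); congr (_ * _).
  by apply: eq_big => // s _; rewrite mxE.
- by move=> t; rewrite [t]ord1.
Qed.

(** The colouring may depend on [A] but not on the solution. Product colourings intersect such sets
    [I], with the zero ideal as the goal. *)
Definition forced (I : R -> Prop) :=
  exists (C : finType) (chi : R -> C), forall x : 'I_l -> R,
    (forall i, \sum_j A i j * x j = 0) -> (forall i j, chi (x i) = chi (x j)) ->
    generalised_columns_condition A \/ forall j, I (x j).

Lemma forced_all (us : seq R) (I : R -> R -> Prop) :
  (forall u, u \in us -> forced (I u)) ->
  forced (fun x => forall u, u \in us -> I u x).
Proof.
elim: us => [|u us IHus] forcedI.
  by exists unit, (fun=> tt) => x _ _; right.
have [C1 [chi1 chi1P]] := forcedI u (mem_head _ _).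
have [C2 [chi2 chi2P]] := IHus (fun v vs => forcedI v (mem_behead (s := u :: us) vs)).
exists (C1 * C2)%type, (fun x => (chi1 x, chi2 x)) => x Ax mono.
have [|//|Iu] := chi1P x Ax; [by move=> i j; case: (mono i j) | by left |].
have [|//|Ius] := chi2P x Ax; [by move=> i j; case: (mono i j) | by left |].
by right=> j v /predU1P[->|] //; apply: Ius.
Qed.

(** Recording the position in a list of [N] makes monochromatic solutions inside [N] constant; their
    common nonzero value serves as [d]. *)
Lemma forced_finite (N : R -> Prop) :
  finite_subset N -> forced N -> forced (fun x => x = 0).
Proof.
move=> [s sN] [C [chi chiP]].
exists (C * 'I_(size s).+1)%type, (fun x => (chi x, inord (index x s))) => x Ax mono.
have [|//|Nx] := chiP x Ax; [by move=> i j; case: (mono i j) | by left |].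
have [|] := pselect (forall j, x j = 0); first by right.
move=> /existsNP[j0 nz0]; left.
apply: (@constant_solution_columns (x j0)); first exact: leq_ltn_trans (ltn_ord j0).
  exact/eqP.
have xE j : x j = x j0.
  have [_ /(congr1 val)] := mono j j0.
  rewrite /= !inordK ?ltnS ?index_size // => /index_inj.
  by move=> /(_ 0 (sN _ (Nx j)) (sN _ (Nx j0))).
move=> i; rewrite -[RHS](Ax i) mulr_sumr; apply: eq_bigr => j _.
by rewrite xE mulrC.
Qed.

Lemma partition_regular_forced :
  partition_regular A -> forced (fun x => x = 0) -> generalised_columns_condition A.
Proof.
move=> prA [C [chi chiP]].
have C_gt0 : (0 < #|C|)%N by apply/card_gt0P; exists (chi 0).
have [m [nzm Am mono]] := prA _ C_gt0 (fun x => enum_rank (chi x)).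
have [|||m0] := chiP (fun j => m j 0); last 2 first.
- by [].
- by case/eqP: nzm; apply/colP => j; rewrite mxE m0.
- by move=> i; have /matrixP/(_ i 0) := Am; rewrite !mxE.
- by move=> i j; apply: enum_rank_inj.
Qed.

Lemma common_denominator (K : fieldType) (pi : {rmorphism R -> K}) (a : 'I_l -> K) :
  (forall z, exists a b, pi b != 0 /\ z * pi b = pi a) ->
  exists d (a' : 'I_l -> R), pi d != 0 /\ forall j, a j * pi d = pi (a' j).
Proof.
move=> fracK.
have /choice[n /choice[b nbP]] : forall j, exists n b, pi b != 0 /\ a j * pi b = pi n.
  by move=> j; apply: fracK.
exists (\prod_j b j), (fun j => n j * \prod_(i | i != j) b i); split=> [|j].
  by rewrite rmorph_prod; apply/prodf_neq0 => j _; case: (nbP j).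
rewrite (bigD1 j) //= !rmorphM mulrA; congr (_ * _).
by case: (nbP j).
Qed.

(** Relations modulo [ann u] become relations in [R] after multiplication by [u]. If [R/ann(u)] is
    finite, colouring by classes gives a constant solution; otherwise the colouring of its fraction
    field applies. *)
Lemma forced_prime (u : R) : prime_ideal (ann u) -> ~ ann u u -> forced (ann u).
Proof.
move=> pr_u nuu; have [[u0 uD uM] _ u_prime] := pr_u.
have nzu : u != 0 by apply: contra_not_neq nuu => ->; rewrite /ann mul0r.
have [K [pi [pi0 piP]]] := residue_field pr_u.
have piE x y : pi x = pi y <-> ann u (x - y).
  by rewrite -pi0 rmorphB; split=> [->|/eqP]; rewrite ?subrr // subr_eq0 => /eqP.
have piA (x : 'I_l -> R) : (forall i, \sum_j A i j * x j = 0) ->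
    forall i, \sum_j pi (A i j) * pi (x j) = 0.
  move=> Ax i; rewrite -[RHS](rmorph0 pi) -(Ax i) rmorph_sum.
  by apply: eq_bigr => j _; rewrite rmorphM.
have [[s sP]|infp] := pselect (finite_mod (ann u)).
  have /choice[r rP] : forall x, exists y, y \in s /\ ann u (x - y).
    by move=> x; have [y ? ?] := sP x; exists y.
  exists 'I_(size s).+1, (fun x => inord (index (r x) s)) => x Ax mono.
  have [|/existsNP[j0 nj0]] := pselect (forall j, ann u (x j)); first by right.
  have xE j : pi (x j) = pi (x j0).
    have /(congr1 val) := mono j j0.
    rewrite /= !inordK ?ltnS ?index_size // => /index_inj rE.
    have [[rj xj] [rj0 xj0]] := (rP (x j), rP (x j0)).
    have {}rE := rE 0 rj rj0.
    by rewrite ((piE _ _).2 xj) ((piE _ _).2 xj0) rE.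
  left; apply: (@constant_solution_columns u) => //.
    exact: leq_ltn_trans (ltn_ord j0).
  move=> i; rewrite mulrC; suff : ann u (\sum_j A i j) by [].
  rewrite -pi0 rmorph_sum; have /eqP := piA x Ax i.
  under eq_bigr do rewrite xE.
  rewrite -mulr_suml mulf_eq0 => /orP[/eqP //|/eqP /pi0 //].
have [C [chi [chi0 chiP]]] := field_columns_colouring (fun i j => pi (A i j)).
exists C, (chi \o pi) => x Ax mono.
have [|/existsNP[j0 nj0]] := pselect (forall j, ann u (x j)); first by right.
left; have [|m [f [f_surj fP]]] := chiP (fun j => pi (x j)) _ (piA x Ax) mono.
  by exists j0; apply/eqP => /pi0.
have /choice[d /choice[a daP]] : forall t, exists d (a : 'I_l -> R), ~ ann u d /\
    forall i, d * \sum_(j | f j == t) A i j * u =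
              \sum_(j | (f j < t)%N) a j * A i j * u.
  move=> t; have [a aP] := fP t.
  have [|d [a' [nzd a'P]]] := common_denominator (pi := pi) a.
    by move=> z; have [v [w [nw zw]]] := piP z; exists v, w; split=> //; apply/eqP => /pi0.
  exists d, a'; split=> [/pi0/eqP|i]; first by rewrite (negbTE nzd).
  rewrite -!mulr_suml mulrA; apply/eqP; rewrite -subr_eq0 -mulrBl.
  apply/eqP/pi0; rewrite rmorphB rmorphM !rmorph_sum /= aP.
  rewrite mulr_sumr -sumrB big1 // => j _.
  by rewrite rmorphM -a'P; ring.
(* Here [u] being outside [ann u] is essential: all products of the chosen multipliers stay outside
   this prime. *)
have nud t : ~ ann u (u * d t) by move/u_prime => [//|]; case: (daP t).
exists m, f, (fun t => u * d t); split=> //.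
- move=> t; apply: contra_not_neq (nud t) => ->; exact: u0.
- apply/matrixP => i j; rewrite !mxE summxE.
  have [_ /(_ i)] := daP ord0; rewrite [X in _ = X]big1 // -mulr_suml => duA.
  rewrite [u * _]mulrC -mulrA [u * _]mulrC -[RHS]duA; congr (_ * (_ * _)).
  by apply: eq_bigr => s _; rewrite mxE.
- move=> t _; have [_ daT] := daP t; exists (fun j => u * a t j).
  apply/matrixP => i j; rewrite !mxE !summxE.
  transitivity (d t * \sum_(s | f s == t) A i s * u).
    rewrite -mulr_suml [u * _]mulrC -mulrA [u * _]mulrC; congr (_ * (_ * _)).
    by apply: eq_bigr => s _; rewrite mxE.
  by rewrite daT; apply: eq_bigr => s _; rewrite !mxE; ring.
- move=> _ n [s sP]; apply: infp.
  set P := \prod_(_ < _ | _) _ in sP; set e := _ * P ^+ n in sP.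
  have nuP : ~ ann u P.
    apply: (big_ind (fun z => ~ ann u z)) => //; first by case: pr_u.
    by move=> y z ny nz /u_prime[].
  have nue : ~ ann u e.
    case/u_prime=> [/nud //|]; elim: n {e sP} => [|n IHn].
      by rewrite expr0; case: pr_u.
    by rewrite exprS => /u_prime[].
  (* Multiplication by [e] separates classes modulo [ann u], so a finite ideal [e R] would make the
     quotient finite. *)
  apply: (@finite_mod_colouring _ _ 'I_(size s).+1 (fun x => inord (index (e * x) s))).
  move=> y z /(congr1 val); rewrite /= !inordK ?ltnS ?index_size // => /index_inj.
  move=> /(_ 0 (sP _ _) (sP _ _)) eyz.
  have : ann u (e * (y - z)) by rewrite mulrBr eyz ?subrr //; [exists y|exists z].
  by case/u_prime.
Qed.

End Forced.

Lemma field_or_finite_rado (R : comPzRingType) : noetherian_ring R ->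
  (forall p : R -> Prop, associated_prime p ->
     quotient_is_finite_field p \/ localisation_is_field p) ->
  rado_ring R.
Proof.
move=> noethR assP k l A prA.
pose G (u : R) := prime_ideal (ann u) /\ ~ ann u u.
have [us [Gus usP]] := noetherian_finite_span G noethR.
pose N (x : R) := forall u, u \in us -> ann u x.
have idN : is_ideal N.
  split=> [u _|x y Nx Ny u us_u|r x Nx u us_u]; have [u0 uD uM] := ann_ideal u => //.
    by apply: uD; [apply: Nx | apply: Ny].
  by apply: uM; apply: Nx.
apply: partition_regular_forced => //; apply: (@forced_finite _ _ _ _ N); last first.
  by apply: forced_all => u /Gus[]; apply: forced_prime.
apply: finite_ideal => // n Nn pr_n.
have [||loc] := assP (ann n); first by split=> //; exists n.
  by case.
have [s [sn ns]] := noetherian_finite_span (ann n) noethR.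
(* This [u] has the same annihilator as [n], so it is special and lies in the span of [us]; but [n]
   kills [us], hence [u], a contradiction. *)
have [u nu un] := localisation_field_annihilator pr_n sn ns loc.
have [[_ _ nM] n1 n_prime] := pr_n.
have uE : ann u = ann n.
  apply/funext => x; apply/propext; split=> [xu|/un]; last by rewrite /ann mulrC.
  have : ann n (x * u) by rewrite (xu : x * u = 0) /ann mul0r.
  by case/n_prime.
have Gu : G u by split; rewrite uE.
case: nu; apply: (usP u Gu); first exact: ann_ideal.
by move=> v /Nn; rewrite /ann mulrC.
Qed.

(** * Necessity *)

Definition unbounded (S : nat -> Prop) := forall m, exists2 n, S n & (m <= n)%N.

Lemma unbounded_pigeonhole (C : finType) (S : nat -> Prop) (col : nat -> C) :
  unbounded S -> exists c, unbounded (fun n => S n /\ col n = c).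
Proof.
move=> unbS; apply: contrapT => noc.
have /choice[b bP] : forall c, exists b, forall n, S n -> col n = c -> (n < b)%N.
  move=> c; apply: contrapT => nob; apply: noc; exists c => m.
  apply: contrapT => nom; apply: nob; exists m => n Sn cn.
  by rewrite ltnNge; apply/negP => lemn; apply: nom; exists n.
have [n Sn] := unbS (\max_c b c).
by rewrite leqNgt (leq_trans (bP _ n Sn erefl)) // leq_bigmax.
Qed.

(** Induction on the palette [L]: among the unboundedly many neighbours joined to [i] by a colour
    [c], either a pair of colour [c] closes a triangle or [c] leaves the palette. *)
Lemma ramsey_triangle (C : finType) (col : nat -> nat -> C) :
  exists i j k, [/\ (i < j)%N, (j < k)%N, col i j = col j k & col i j = col i k].
Proof.
suff : forall n (L : {set C}) S, #|L| = n -> unbounded S ->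
    (forall i j, S i -> S j -> (i < j)%N -> col i j \in L) ->
    exists i j k, [/\ (i < j)%N, (j < k)%N, col i j = col j k & col i j = col i k].
  move/(_ _ [set: C]%SET xpredT erefl); apply=> [m|]; first by exists m.
  by move=> i j _ _ _; rewrite finset.in_setT.
elim=> [|n IHn] L S.
  move/eqP; rewrite cards_eq0 => /eqP-> unbS colS.
  have [i Si _] := unbS 0%N; have [j Sj ltij] := unbS i.+1.
  by have := colS i j Si Sj ltij; rewrite finset.in_set0.
move=> cardL unbS colS; have [i Si _] := unbS 0%N.
pose S1 m := S m /\ (i < m)%N.
have unbS1 : unbounded S1.
  move=> m; have [j Sj] := unbS (maxn m i.+1); rewrite geq_max => /andP[mj ij].
  by exists j.
have [c unbc] := unbounded_pigeonhole (col i) unbS1.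
have [[j [k [[[_ ij] cj] [[_ ik] ck] jk cjk]]]|noc] := pselect (exists j k,
    [/\ S1 j /\ col i j = c, S1 k /\ col i k = c, (j < k)%N & col j k = c]).
  by exists i, j, k; split; rewrite ?cj ?ck ?cjk.
apply: (IHn (L :\ c) (fun m => S1 m /\ col i m = c)) => // [|j k S1j S1k jk].
  have [j [[Sj ij] cj] _] := unbc 0%N.
  by apply/eqP; rewrite -eqSS -cardL (cardsD1 c L) -cj (colS i j Si Sj ij).
rewrite !inE; apply/andP; split.
  by apply/eqP => cjk; apply: noc; exists j, k.
by apply: colS => //; [case: S1j => -[]|case: S1k => -[]].
Qed.

Lemma infinite_mod_sequence (R : comPzRingType) (p : R -> Prop) :
  is_ideal p -> ~ finite_mod p ->
  exists g : nat -> R, forall i j, (i < j)%N -> ~ p (g j - g i).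
Proof.
move=> idp infp.
have /choice[next nextP] : forall s : seq R, exists x, forall y, y \in s -> ~ p (x - y).
  move=> s; apply: contrapT => nox; apply: infp; exists s => x.
  apply: contrapT => noy; apply: nox; exists x => y sy pxy; apply: noy.
  by exists y.
pose hist n := iter n (fun s => next s :: s) [::].
exists (fun n => next (hist n)) => i j ij; apply: nextP.
elim: j ij => // j IHj; rewrite ltnS leq_eqVlt => /predU1P[->|/IHj ij].
  exact: mem_head.
by rewrite inE ij orbT.
Qed.

Lemma finite_mod_repetition (R : comPzRingType) (p : R -> Prop) (g : nat -> R) :
  is_ideal p -> finite_mod p -> exists i j, (i < j)%N /\ p (g j - g i).
Proof.
move=> idp [s sP].
have /choice[r rP] : forall n, exists y, y \in s /\ p (g n - y).
  by move=> n; have [y ? ?] := sP (g n); exists y.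
have [|c unbc] := @unbounded_pigeonhole 'I_(size s).+1 xpredT
    (fun n => inord (index (r n) s)); first by move=> m; exists m.
have [i [_ ci] _] := unbc 0%N; have [j [_ cj] ij] := unbc i.+1.
exists i, j; split=> //.
have /(congr1 val) : inord (index (r j) s) = inord (index (r i) s) :> 'I_(size s).+1.
  by rewrite ci cj.
have [[ri pri] [rj prj]] := (rP i, rP j).
rewrite /= !inordK ?ltnS ?index_size // => /index_inj rE; have {}rE := rE 0 rj ri.
have -> : g j - g i = g j - r j - (g i - r i) by rewrite rE opprB addrA subrK.
exact: is_idealB.
Qed.

(** Two powers of [x] agree modulo [p]; cancelling the smaller one exhibits an inverse. *)
Lemma finite_domain_field (R : comPzRingType) (p : R -> Prop) :
  prime_ideal p -> finite_mod p -> quotient_is_finite_field p.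
Proof.
move=> pr_p finp; have [idp np1 p_or] := pr_p.
split=> // x npx.
have npX i : ~ p (x ^+ i).
  by elim: i => [|i IHi]; rewrite ?expr0 // exprS => /p_or[].
have [i [j [ij]]] := finite_mod_repetition (fun n => x ^+ n) idp finp.
rewrite -(subnK (ltnW ij)) exprD -[X in _ - X]mul1r -mulrBl => /p_or[|/npX//].
by rewrite -subn_gt0 in ij; rewrite -(prednK ij) exprS; exists (x ^+ (j - i).-1).
Qed.

(** If [d] outside [p] killed [p], every nonzero fraction would have its numerator outside [p],
    hence an inverse. *)
Lemma not_localisation_field (R : comPzRingType) (p : R -> Prop) :
  prime_ideal p -> ~ localisation_is_field p ->
  forall d, (forall x, p x -> d * x = 0) -> p d.
Proof.
move=> [[p0 pD pM] np1 p_or] nloc d dp; apply: contrapT => npd; apply: nloc.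
split=> [[u [npu]]|a s nps nka]; first by rewrite mulr1 => u0; apply: npu; rewrite u0.
have npa : ~ p a by move=> pa; apply: nka; exists d; split=> //; apply: dp.
by exists s, a, 1; split=> //; rewrite mul1r mulrC subrr.
Qed.

(* The system [x - y + z = 0], [a x = a y = a z = 0] for [a] in a finite list. *)
Definition killed_schur_entry (R : comPzRingType) (s : seq R)
    (r : option ('I_(size s) * 'I_3)) (j : 'I_3) : R :=
  if r is Some (i, j') then (if j == j' then s`_i else 0) else (-1) ^+ j.

Definition killed_schur_matrix (R : comPzRingType) (s : seq R) :
    'M[R]_(#|{: option ('I_(size s) * 'I_3)}|, 3) :=
  \matrix_(r, j) killed_schur_entry (enum_val r) j.

Lemma killed_schur_regular (R : comPzRingType) (s : seq R) (c : R) :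
  (forall y, y \in s -> y * c = 0) -> ~ finite_mod (ann c) ->
  partition_regular (killed_schur_matrix s).
Proof.
move=> sc infc r r_gt0 chi.
have [g gP] := infinite_mod_sequence (ann_ideal c) infc.
(* Schur's argument: pairs are coloured by differences, and a triangle gives the solution. *)
have [i [j [k [ij jk cij cik]]]] :=
  ramsey_triangle (fun i j => chi ((g j - g i) * c)).
pose v (t : 'I_3) := [:: g j - g i; g k - g i; g k - g j]`_t.
exists (\col_t (v t * c)); split.
- by apply/eqP => /matrixP/(_ 0 0) /eqP; rewrite !mxE => /eqP; apply: gP.
- apply/matrixP => a b; rewrite !mxE.
  under eq_bigr do rewrite !mxE.
  case: (enum_val a) => [[n t]|] /=.
    rewrite (bigD1 t) //= eqxx big1 => [|t' /negbTE->]; last by rewrite mul0r.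
    by rewrite mulrCA sc ?mulr0 ?addr0 ?mem_nth.
  rewrite !big_ord_recl big_ord0 /v /= addr0.
  rewrite expr0 expr1 expr2 mulrNN !mul1r mulN1r -mulNr -!mulrDl.
  by rewrite opprB [_ + (g k - _)]addrA subrK addrA subrK subrr mul0r.
- suff mono t : chi (v t * c) = chi ((g j - g i) * c) by move=> t t'; rewrite !mxE !mono.
  by case: t => -[|[|[|//]]] ? /=.
Qed.

Lemma killed_schur_columns (R : comPzRingType) (s : seq R) (p : R -> Prop) :
  (forall x, p x -> ideal_span s x) ->
  (forall d, (forall x, p x -> d * x = 0) -> p d) ->
  ~ generalised_columns_condition (killed_schur_matrix s).
Proof.
move=> ps faithful [m [f [d [f_surj nzd d0 dt inf]]]].
have kill e : (forall i : 'I_(size s), e * s`_i = 0) -> forall x, p x -> e * x = 0.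
  move=> es x /ps; apply: mul_ideal_span0 => y sy; rewrite -(nth_index 0 sy).
  have iy : (index y s < size s)%N by rewrite index_mem.
  exact: (es (Ordinal iy)).
have entry (r : option ('I_(size s) * 'I_3)) j :
    killed_schur_matrix s (enum_rank r) j = killed_schur_entry r j.
  by rewrite mxE enum_rankK.
have row_sum i j :
    \sum_(j' | f j' == f j) killed_schur_matrix s (enum_rank (Some (i, j))) j' = s`_i.
  rewrite (bigD1 j) //= entry /= eqxx big1 ?addr0 // => j' /andP[_ /negbTE jj'].
  by rewrite entry /= jj'.
have d0P r : d ord0 * \sum_(j | f j == ord0) killed_schur_matrix s r j = 0.
  have /matrixP/(_ r 0) := d0; rewrite !mxE summxE => d0r; rewrite -[RHS]d0r; congr (_ * _).
  by apply: eq_bigr => j _; rewrite [RHS]mxE.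
have kill0 : forall x, p x -> d ord0 * x = 0.
  apply: kill => i; have [j fj] := f_surj ord0.
  by rewrite -(row_sum i j) fj d0P.
case: m => [|m] in f d f_surj nzd d0 dt inf row_sum d0P kill0 *.
  (* With one class, the row of [x - y + z] has sum 1, which would force [d ord0] to be zero. *)
  have := d0P (enum_rank None); under eq_bigr do rewrite entry.
  rewrite (eq_bigl xpredT) => [|j]; last by rewrite [f j]ord1 eqxx.
  rewrite !big_ord_recl big_ord0 /= expr0 expr1 expr2 mulrNN mul1r addr0.
  by rewrite addNr addr0 mulr1; apply/eqP.
pose t : 'I_m.+2 := inord 1.
have t_gt0 : (0 < t)%N by rewrite inordK.
(* For [j] in class [t], row [(i, j)] vanishes on all columns of earlier classes, so [d t] must kill
   its only possibly nonzero entry. *)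
have killt : forall x, p x -> d t * x = 0.
  apply: kill => i; have [j fj] := f_surj t.
  have [a /matrixP/(_ (enum_rank (Some (i, j))) 0)] := dt t t_gt0.
  rewrite !mxE !summxE => dtE; rewrite -(row_sum i j) fj.
  transitivity (d t * \sum_(j' | f j' == t)
      col j' (killed_schur_matrix s) (enum_rank (Some (i, j))) 0).
    by congr (_ * _); apply: eq_bigr => j' _; rewrite [RHS]mxE.
  rewrite dtE big1 // => j' ltj'; rewrite !mxE enum_rankK /=.
  by case: eqP ltj' => [->|_ _]; rewrite ?fj ?ltnn // mulr0.
(* Both multipliers kill [p], so [d t] lies in [p] and is killed by [d ord0]; the ideal for exponent
   1 is then zero. *)
have d0t : d ord0 * d t = 0 by apply/kill0/faithful.
apply: (inf isT 1%N); exists [:: 0] => x [y ->].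
by rewrite expr1 (bigD1 t) //= mulrA d0t !mul0r mem_head.
Qed.

Lemma rado_associated_prime (R : comPzRingType) (p : R -> Prop) :
  noetherian_ring R -> rado_ring R -> associated_prime p ->
  quotient_is_finite_field p \/ localisation_is_field p.
Proof.
move=> noethR radoR [pr_p [c pc]].
have [/(finite_domain_field pr_p)|infp] := pselect (finite_mod p); first by left.
right; apply: contrapT => nloc.
have [s [sp ps]] := noetherian_finite_span p noethR.
have pE : p = ann c by apply/funext => x; apply/propext.
apply: (killed_schur_columns ps (not_localisation_field pr_p nloc)).
apply: radoR; apply: (@killed_schur_regular _ _ c); last by rewrite -pE.
by move=> y /sp; rewrite pE.
Qed.

Theorem theorem4p3 (R : comPzRingType) :
  noetherian_ring R ->
  (rado_ring R <->
   forall p : R -> Prop, associated_prime p ->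
     quotient_is_finite_field p \/ localisation_is_field p).
Proof.
move=> noethR; split=> [radoR p|]; first exact: rado_associated_prime.
exact: field_or_finite_rado.
Qed.
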